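(* Let $m\in\mathbb{N}$ and let $f$ be a real-valued continuous function on $[0,\infty)$ with $f\le1$, analytic at the origin with Taylor series expansion $$f(z)=\sum_{j=0}^\infty(-1)^ja_jz^{2j},\qquad a_0=1,\quad a_j>0,\ j\in\mathbb{N}.$$ Then $f\notin\Phi_{m+1}$ provided that $$\frac{2m+6}{m+1}\,a_2<a_1^2.$$ In particular, $\Omega_n\in\Phi_n\setminus\Phi_{n+1}$ for every $n\in\mathbb{N}$.
   Context: For $n\in\mathbb{N}$, $|\cdot|_n$ is the Euclidean norm on $\mathbb{R}^n$. $\Phi_n$ is the class of radial positive definite functions on $\mathbb{R}^n$: real-valued continuous functions $f$ on $[0,\infty)$ such that for every finite set $\{x_1,\dots,x_N\}\subset\mathbb{R}^n$ and all $\xi_1,\dots,\xi_N\in\mathbb{C}$ one has $\sum_{k,j=1}^N f(|x_k-x_j|_n)\,\xi_j\overline{\xi_k}\ge 0$. The Schoenberg kernel is, with $q=\frac n2-1$, $$\Omega_n(s)=\Gamma(q+1)\Big(\frac2s\Big)^qJ_q(s)=\sum_{j=0}^\infty\frac{\Gamma(q+1)}{j!\,\Gamma(j+q+1)}\Big(-\frac{s^2}{4}\Big)^j,$$ where $J_q$ is the Bessel function of the first kind of order $q$. *)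

(* Defs.v *)
From HB Require Import structures.
From mathcomp Require Import all_boot all_order all_algebra.
From mathcomp Require Import all_classical all_reals all_analysis.
From mathcomp Require Import complex ring.
Import Order.TTheory GRing.Theory Num.Theory.
Import numFieldNormedType.Exports.

Set Implicit Arguments.
Unset Strict Implicit.
Unset Printing Implicit Defensive.

Local Open Scope classical_set_scope.
Local Open Scope ring_scope.

(* The library norm on 'rV[R]_n is the sup norm, hence this definition. *)
Definition enorm (R : realType) (n : nat) (x : 'rV[R]_n) : R :=
  Num.sqrt (\sum_(i < n) x ord0 i ^+ 2).

(* A function on [0, +oo) is given by a map R -> R whose values at negative
   arguments are irrelevant. The order on R[i] makes [0 <= z] mean that z is
   real and nonnegative. *)
Definition Phi (R : realType) (n : nat) : set (R -> R) :=
  [set f : R -> R | {within `[(0:R), +oo[, continuous f} /\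
    forall (N : nat) (x : 'I_N -> 'rV[R]_n) (xi : 'I_N -> R[i]),
      injective x ->
      0 <= \sum_(k < N) \sum_(j < N)
             (f (enorm (x k - x j)))%:C%C * xi j * (xi k)^*%C ].

Definition Gamma (R : realType) (x : R) : R :=
  \int[@lebesgue_measure R]_(t in `]0, +oo[) (t `^ (x - 1) * expR (- t)).

Definition bessel_J (R : realType) (q s : R) : R :=
  limn (series (fun j : nat =>
    (-1) ^+ j / (j`!%:R * Gamma (j%:R + q + 1)) * (s / 2) `^ (2 * j%:R + q))).

Definition bessel_order (R : realType) (n : nat) : R := n%:R / 2 - 1.

(* The Schoenberg kernel, by its power series, which also covers s = 0;
   [OmegaE] gives the closed form in terms of the Bessel function. *)
Definition Omega (R : realType) (n : nat) (s : R) : R :=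
  let q := bessel_order R n in
  limn (pseries (fun j : nat => Gamma (q + 1) / (j`!%:R * Gamma (j%:R + q + 1)))
                (- (s ^+ 2 / 4))).

(* No convergence hypothesis: [limn] of a divergent real sequence is 0. *)
Lemma limnMl_total (R : realType) (c : R) (u : R ^nat) :
  limn (fun k => c * u k) = c * limn u.
Proof.
have [->|c0] := eqVneq c 0.
  rewrite mul0r (_ : (fun k => 0 * u k) = (fun=> 0)); last first.
    by apply/funext => k; rewrite mul0r.
  exact: lim_cst.
have [cu|ncu] := pselect (cvgn u); first by apply: cvg_lim => //; exact: cvgMl_tmp.
rewrite (dvgP ncu) dvgP; first by rewrite mulr0.
move=> /(is_cvgMl_tmp (a := c^-1)) h; apply: ncu.
suff -> : u = (fun k => c^-1 * (c * u k)) by exact: h.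
by apply/funext => k; rewrite mulrA mulVf ?mul1r.
Qed.

Lemma OmegaE (R : realType) (n : nat) (s : R) : 0 < s ->
  let q := bessel_order R n in
  Omega n s = Gamma (q + 1) * (2 / s) `^ q * bessel_J q s.
Proof.
move=> s0 q; rewrite /Omega -/q /bessel_J.
move: (q) => {}q; rewrite -limnMl_total; congr (lim (_ @ \oo)).
apply/funext => k; rewrite /pseries /series /= mulr_sumr.
apply: eq_bigr => j _.
have h0 : 0 < s / 2 by rewrite divr_gt0.
have -> : 2 / s = (s / 2)^-1 by rewrite invf_div.
rewrite powRD; last by rewrite (gt_eqF h0) implybT.
rewrite -natrM powR_mulrn ?ltW// exprM.
have -> : - (s ^+ 2 / 4) = (-1) * (s / 2) ^+ 2.
  by rewrite mulN1r expr_div_n -natrX.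
rewrite exprMn.
have pN : (s / 2)^-1 `^ q * (s / 2) `^ q = 1.
  by rewrite -powRM ?invr_ge0 ?ltW// mulVf ?gt_eqF// powR1.
move: pN; move: ((s / 2)^-1 `^ q) ((s / 2) `^ q) => A B AB.
rewrite -[LHS]mulr1 -AB; ring.
Qed.

(* Main.v *)
Require Import Defs.
From HB Require Import structures.
From mathcomp Require Import all_boot all_order all_algebra.
From mathcomp Require Import all_classical all_reals all_analysis.
From mathcomp Require Import complex.
From mathcomp Require Import measurable_realfun ring lra.
Import Order.TTheory GRing.Theory Num.Theory.
Import numFieldNormedType.Exports.

Set Implicit Arguments.
Unset Strict Implicit.
Unset Printing Implicit Defensive.

Local Open Scope classical_set_scope.
Local Open Scope ring_scope.

(** If x |-> f (|x|) is positive definite on R^N, then testing it against a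
    discretisation of the measure (Laplacian + c) delta_0 shows that
    (Laplacian + c)^2 F (0) >= 0 for every real c, where F (x) = f (|x|); the
    discriminant of this quadratic polynomial in c gives
    (Laplacian F (0))^2 <= F (0) * Laplacian^2 F (0).  Since
    Laplacian |x|^2 = 2N and Laplacian^2 |x|^4 = 8N(N+2), this reads
    N a_1^2 <= (2N+4) a_2 ([fourth_order_necessary]), which contradicts the
    hypothesis on a_1 and a_2 for N = m+1.  For Omega_n one has a_1 = 1/(2n) and
    a_2 = 1/(8n(n+2)), so the inequality is an equality in dimension n and
    fails in dimension n+1 ([Omega_notin_PhiS]).

    That Omega_n is positive definite on R^n is proved by a limit of explicit
    positive definite functions instead of an integral over the sphere.  As a
    function of t = |x|^2 the kernel is a power series with coefficients
    [omega], chosen so that minus the Laplacian maps omega_(j+1) t^(j+1) to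
    omega_j t^j: it is a backward shift.  Minus the Laplacian preserves positive
    definiteness, being a limit of second differences
    ([radial_psd_laplacian]).  Applying it D times to the Gaussian
    exp (- t/(4D)) and normalising the value at 0 gives the coefficients
    omega_j * prod_(i < j) (1 + (n/2 + i)/D), which tend to omega_j as D grows,
    with an error O(1/D) that is summable in j ([beta_le]); hence the limit
    Omega_n is positive definite ([radial_psd_omega]).

    The link with the definition of Omega_n through the Gamma integral is the
    functional equation Gamma (x + 1) = x Gamma (x), obtained from integration
    by parts on the intervals [1/k, k] and monotone convergence, together with
    0 < Gamma (x) < +oo ([GammaS], [Gamma_gt0]). *)

(** * Positive semidefinite kernels *)

Section PositiveKernels.
Context {R : realType}.

(** Weighted points are kept in a list, so that configurations of points can be
    concatenated and may contain repetitions. *)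
Definition quad (V : Type) (K : V -> V -> R) (s : seq (V * R)) : R :=
  \sum_(p <- s) \sum_(q <- s) K p.1 q.1 * (p.2 * q.2).

Definition psd (V : Type) (K : V -> V -> R) : Prop := forall s, 0 <= quad K s.

Lemma psd_ext (V : Type) (K L : V -> V -> R) :
  (forall x y, K x y = L x y) -> psd K -> psd L.
Proof.
move=> KL pK s; suff -> : quad L s = quad K s by exact: pK.
by apply: eq_bigr => p _; apply: eq_bigr => q _; rewrite KL.
Qed.

Lemma psd_sum (V : Type) (I : Type) (r : seq I) (K : I -> V -> V -> R) :
  (forall i, psd (K i)) -> psd (fun x y => \sum_(i <- r) K i x y).
Proof.
move=> pK s.
have -> : quad (fun x y => \sum_(i <- r) K i x y) s = \sum_(i <- r) quad (K i) s.
  rewrite /quad [RHS]exchange_big; apply: eq_bigr => p _ /=.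
  by rewrite [RHS]exchange_big; apply: eq_bigr => q _ /=; rewrite mulr_suml.
by apply: sumr_ge0 => i _; exact: pK.
Qed.

Lemma psd_scale (V : Type) (c : R) (K : V -> V -> R) :
  0 <= c -> psd K -> psd (fun x y => c * K x y).
Proof.
move=> c0 pK s.
have -> : quad (fun x y => c * K x y) s = c * quad K s.
  rewrite [RHS]mulr_sumr; apply: eq_bigr => p _.
  by rewrite [RHS]mulr_sumr; apply: eq_bigr => q _; rewrite [RHS]mulrA.
by rewrite mulr_ge0.
Qed.

Lemma psd_congruence (V : Type) (g : V -> R) (K : V -> V -> R) :
  psd K -> psd (fun x y => g x * g y * K x y).
Proof.
move=> pK s; have := pK [seq (p.1, g p.1 * p.2) | p <- s].
rewrite /quad big_map => /le_trans; apply; rewrite le_eqVlt; apply/orP; left.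
apply/eqP; apply: eq_bigr => p _; rewrite big_map.
by apply: eq_bigr => q _ /=; ring.
Qed.

Lemma cvg_bigsum (T I : Type) (F : set_system T) (FF : Filter F) (r : seq I)
    (f : I -> T -> R) (l : I -> R) :
  (forall i, f i @ F --> l i) ->
  \sum_(i <- r) f i x @[x --> F] --> \sum_(i <- r) l i.
Proof.
move=> fl; elim: r => [|i r IH].
  by rewrite big_nil; under eq_fun do rewrite big_nil; exact: cvg_cst.
by rewrite big_cons; under eq_fun do rewrite big_cons; exact: cvgD.
Qed.

Lemma psd_lim (T V : Type) (F : set_system T) (FF : ProperFilter F)
    (K : T -> V -> V -> R) (L : V -> V -> R) :
  (\forall h \near F, psd (K h)) ->
  (forall x y, K h x y @[h --> F] --> L x y) -> psd L.
Proof.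
move=> pK KL s.
have cK : quad (K h) s @[h --> F] --> quad L s.
  apply: cvg_bigsum => p; apply: cvg_bigsum => q.
  by apply: cvgMr_tmp; exact: KL.
rewrite -(cvg_lim _ cK)//; apply: limr_ge; first by apply/cvg_ex; exists (quad L s).
by apply: filterS pK => h; exact.
Qed.

Definition dot n (x y : 'rV[R]_n) : R := \sum_(i < n) x ord0 i * y ord0 i.
Definition sqnorm n (x : 'rV[R]_n) : R := \sum_(i < n) x ord0 i ^+ 2.

(** Induction on [l]: multiplying a kernel by the dot product is a sum over the
    coordinates of congruences. *)
Lemma psd_dotX n l : psd (fun x y : 'rV[R]_n => dot x y ^+ l).
Proof.
elim: l => [s|l IH].
  have -> : quad (fun x y : 'rV[R]_n => dot x y ^+ 0) s = (\sum_(p <- s) p.2) ^+ 2.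
    rewrite expr2 mulr_suml; apply: eq_bigr => p _.
    by rewrite mulr_sumr; apply: eq_bigr => q _; rewrite expr0 mul1r.
  exact: sqr_ge0.
have := psd_sum (index_enum 'I_n) (fun i => psd_congruence (fun x : 'rV[R]_n => x ord0 i) IH).
by apply: psd_ext => x y; rewrite exprS mulr_suml.
Qed.

(** The partial sums of the exponential series are nonnegative combinations of
    powers of the dot product. *)
Lemma psd_exp_dot n (c : R) : 0 <= c ->
  psd (fun x y : 'rV[R]_n => expR (c * dot x y)).
Proof.
move=> c0.
apply: (@psd_lim nat _ \oo _
  (fun m x y => series (exp_coeff (c * dot x y)) m)).
  apply: nearW => m; apply: psd_sum => l.
  have : psd (fun x y : 'rV[R]_n => c ^+ l / l`!%:R * dot x y ^+ l).
    by apply: psd_scale _ (@psd_dotX n l); rewrite divr_ge0// exprn_ge0.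
  by apply: psd_ext => x y; rewrite /exp_coeff /= exprMn mulrAC.
by move=> x y; exact: is_cvg_series_exp_coeff.
Qed.

Lemma sqnormB n (x y : 'rV[R]_n) :
  sqnorm (x - y) = sqnorm x + sqnorm y - 2 * dot x y.
Proof.
rewrite /sqnorm /dot mulr_sumr -sumrN -!big_split /=.
by apply: eq_bigr => i _; rewrite !mxE; ring.
Qed.

Definition radial_psd n (phi : R -> R) : Prop :=
  psd (fun x y : 'rV[R]_n => phi (sqnorm (x - y))).

(** |x - y|^2 = |x|^2 + |y|^2 - 2 <x, y>, so the Gaussian kernel is congruent to
    exp (2c <x, y>). *)
Lemma radial_psd_gauss n (c : R) : 0 <= c ->
  radial_psd n (fun t => expR (- (c * t))).
Proof.
move=> c0; have := psd_congruence (fun x : 'rV[R]_n => expR (- (c * sqnorm x)))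
  (@psd_exp_dot n (2 * c) (mulr_ge0 (ler0n _ 2) c0)).
apply: psd_ext => x y; rewrite -!expRD sqnormB; congr expR; ring.
Qed.

End PositiveKernels.

(** * The Laplacian preserves radial positive definiteness *)

Section Laplacian.
Context {R : realType}.

(** Splitting every point p of weight w into p with weight w and p + e with
    weight -w turns the quadratic form of [k] into that of its second
    difference in the direction [e]. *)
Lemma psd_second_difference (V : zmodType) (k : V -> R) (e : V) :
  psd (fun x y => k (x - y)) ->
  psd (fun x y => 2 * k (x - y) - k (x - y - e) - k (x - y + e)).
Proof.
move=> pk s; have := pk (s ++ [seq (p.1 + e, - p.2) | p <- s]).
move=> /le_trans; apply; rewrite le_eqVlt; apply/orP; left; apply/eqP.
rewrite /quad big_cat big_map /= -big_split; apply: eq_bigr => p _ /=.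
rewrite !big_cat !big_map /= -!big_split; apply: eq_bigr => q _ /=.
have -> : p.1 - (q.1 + e) = p.1 - q.1 - e by rewrite opprD addrA.
have -> : p.1 + e - q.1 = p.1 - q.1 + e by rewrite addrAC.
have -> : p.1 + e - (q.1 + e) = p.1 - q.1 by rewrite opprD addrACA subrr addr0.
ring.
Qed.

(** Second order Taylor-Young expansion, from the mean value theorem applied to
    the remainder.  The form with a remainder factor [rho] continuous at 0 makes
    the limits of difference quotients below mere compositions of limits. *)
Lemma taylor2 (f f1 : R -> R) (t c : R) :
  (forall x : R, is_derive x (1:R) f (f1 x)) -> is_derive t (1:R) f1 c ->
  exists2 rho : R -> R, rho 0 = 0 /\ {for 0, continuous rho} &
    forall u, f (t + u) = f t + u * f1 t + u ^+ 2 * (c / 2 + rho u).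
Proof.
move=> df df1.
pose r u := f (t + u) - f t - u * f1 t - u ^+ 2 * (c / 2).
exists (fun u => r u / u ^+ 2); last first.
  move=> u; have [->|u0] := eqVneq u 0; first by rewrite expr0n !mul0r !addr0.
  by rewrite /r; field; rewrite ?u0.
have r0 : r 0 / 0 ^+ 2 = 0 by rewrite expr0n invr0 mulr0.
split=> //; suff : r u / u ^+ 2 @[u --> 0] --> (0:R) by rewrite -{2}r0; exact.
apply/cvgrPdist_le => /= e e0.
pose dr u := f1 (t + u) - f1 t - u * c.
have isdr (x : R) : is_derive x (1:R) r (dr x).
  have h : is_derive x (1:R) (f \o shift t) (f1 (t + x)).
    rewrite addrC -[f1 _]mulr1.
    exact: (@is_derive1_comp _ f (shift t) x _ _ (df _) (is_derive_shift x 1 t)).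
  have -> : r = (f \o shift t) - cst (f t) - f1 t *: id - (c / 2) *: (fun u => u ^+ 2).
    apply/funext => u; rewrite /r !fctE /= [t + u]addrC.
    by congr (_ - _ - _); rewrite mulrC.
  apply: is_derive_eq; rewrite /dr.
  by rewrite subr0 /GRing.scale /= !mulr1; field.
have drsmall : \forall u \near 0, `|dr u| <= e * `|u|.
  have lim1 : h^-1 * (f1 (t + h) - f1 t) @[h --> 0^'] --> c.
    rewrite -(@derive_val _ _ _ _ _ _ _ df1).
    have : cvg (h^-1 *: ((f1 \o shift t) (h *: (1:R)) - f1 t) @[h --> 0^']) by exact: ex_derive.
    rewrite /derive; apply: cvg_trans; apply: near_eq_cvg; apply: nearW => k /=.
    by rewrite [k *: 1]mulr1 [k + t]addrC.
  move/cvgrPdist_le: lim1 => /(_ e e0); rewrite near_withinE.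
  apply: filterS => h H; have [->|h0] := eqVneq h 0.
    by rewrite /dr addr0 subrr mul0r subrr normr0 mulr0.
  have := H h0; rewrite distrC -(@ler_pM2r _ `|h|) ?normr_gt0// -normrM.
  congr (`|_| <= _); rewrite /dr; field; exact: h0.
move/nbhs_ballP: drsmall => [d /= d0 dsmall].
apply/nbhs_ballP; exists d => //= u ud.
have bd v : `|v| <= `|u| -> `|dr v| <= e * `|u|.
  move=> vu; apply: (@le_trans _ _ (e * `|v|)); last by rewrite ler_pM2l.
  apply: dsmall; move: ud; rewrite /ball /= !sub0r !normrN; exact: le_lt_trans.
have cr (a b : R) : {within `[a, b], continuous r}.
  by apply: continuous_subspaceT => x; apply/differentiable_continuous/derivable1_diffP; exact: ex_derive.
rewrite sub0r normrN.
have r00 : r 0 = 0 by rewrite /r addr0 subrr !mul0r expr0n mul0r !subr0.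
have [u0|u0|->] := ltgtP u 0; last by rewrite r0 normr0 ltW.
- have [v] := MVT u0 (fun x _ => isdr x) (cr _ _).
  rewrite in_itv /= => /andP[uv v0]; rewrite r00 !sub0r => /eqP; rewrite mulrN eqr_opp => /eqP ->.
  rewrite expr2 -mulf_div divff ?lt_eqF// mulr1 normrM normfV ler_pdivrMr ?normr_gt0 ?lt_eqF//.
  by apply: bd; rewrite !ltr0_norm// lerN2 ltW.
- have [v] := MVT u0 (fun x _ => isdr x) (cr _ _).
  rewrite in_itv /= => /andP[v0 uv]; rewrite r00 !subr0 => ->.
  rewrite expr2 -mulf_div divff ?gt_eqF// mulr1 normrM normfV ler_pdivrMr ?normr_gt0 ?gt_eqF//.
  by apply: bd; rewrite !gtr0_norm// ltW.
Qed.

(** The function of t in the conclusion is minus the Laplacian of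
    x |-> f (|x|^2), evaluated at |x|^2 = t; it is the limit, as h tends to 0,
    of the sum over the n coordinate directions of the second differences with
    step h, divided by h^2. *)
Lemma radial_psd_laplacian n (f f1 f2 : R -> R) :
  (forall x : R, is_derive x (1:R) f (f1 x)) -> (forall x : R, is_derive x (1:R) f1 (f2 x)) ->
  radial_psd n f ->
  radial_psd n (fun t => - (4 * t * f2 t + 2 * n%:R * f1 t)).
Proof.
move=> df df1 pf.
pose D (h : R) (x y : 'rV[R]_n) := h ^- 2 * \sum_(i < n)
  (let t := sqnorm (x - y) in let z := (x - y) ord0 i in
   2 * f t - f (t + (h ^+ 2 - 2 * h * z)) - f (t + (h ^+ 2 + 2 * h * z))).
apply: (@psd_lim R R _ 0^' _ D).
  near=> h; apply: psd_scale; first by rewrite invr_ge0 sqr_ge0.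
  apply: psd_sum => i.
  have := @psd_second_difference _ (fun z : 'rV[R]_n => f (sqnorm z))
    (h *: delta_mx ord0 i) pf.
  have sqe (z : 'rV[R]_n) (k : R) :
      sqnorm (z + k *: delta_mx ord0 i) = sqnorm z + (k ^+ 2 + 2 * k * z ord0 i).
    rewrite /sqnorm (bigD1 i)//= [in RHS](bigD1 i)//= !mxE !eqxx /=.
    rewrite (eq_bigr (fun j => z ord0 j ^+ 2)).
      by ring.
    by move=> j ji; rewrite !mxE eqxx (negbTE ji) /= mulr0 addr0.
  apply: psd_ext => x y.
  by rewrite -scaleNr !sqe sqrrN mulrN mulNr.
move=> x y; rewrite /D; set t := sqnorm (x - y).
have [rho [rho0 crho] Ef] := taylor2 df (df1 t).
(* [G h] is [D h x y] with the factor h^2 cancelled; it makes sense and is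
   continuous at h = 0. *)
pose G (h : R) := \sum_(i < n) (let z := (x - y) ord0 i in
  - (2 * f1 t + (h - 2 * z) ^+ 2 * (f2 t / 2 + rho (h ^+ 2 - 2 * h * z))
      + (h + 2 * z) ^+ 2 * (f2 t / 2 + rho (h ^+ 2 + 2 * h * z)))).
have -> : - (4 * t * f2 t + 2 * n%:R * f1 t) = G 0.
  rewrite /G (eq_bigr (fun i : 'I_n =>
     - (2 * f1 t) + (x - y) ord0 i ^+ 2 * (- (4 * f2 t)))); last first.
    by move=> i _ /=; rewrite expr0n !mulr0 !mul0r subr0 addr0 rho0; field.
  rewrite big_split /= -mulr_suml -/(sqnorm _) -/t sumr_const card_ord -mulr_natr.
  ring.
have cG : G h @[h --> 0^'] --> G 0.
  have crhoc (k : R) : rho (h ^+ 2 + k * h) @[h --> (0:R)] --> rho 0.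
    have pk : h ^+ 2 + k * h @[h --> (0:R)] --> (0:R).
      rewrite [X in _ --> X](_ : 0 = 0 ^+ 2 + k * 0); last by rewrite expr0n mulr0 addr0.
      by apply: cvgD; [exact: exprn_continuous|apply: cvgMl_tmp; exact: cvg_id].
    exact: (cvg_comp _ _ pk crho).
  have cz (k : R) : (h + k) ^+ 2 @[h --> (0:R)] --> (0 + k) ^+ 2.
    have hk : h + k @[h --> (0:R)] --> 0 + k.
      by apply: cvgD; [exact: cvg_id|exact: cvg_cst].
    exact: (cvg_comp _ _ hk (@exprn_continuous _ 2 (0 + k))).
  apply: cvg_bigsum => i /=; apply: cvg_within_filter; set z := (x - y) ord0 i.
  apply: cvgN; apply: cvgD; first apply: cvgD; first exact: cvg_cst.
    apply: cvgM; first exact: cz.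
    apply: cvgD; first exact: cvg_cst.
    have := crhoc (- (2 * z)).
    rewrite expr0n mulr0 mul0r subr0; apply: cvg_trans; apply: near_eq_cvg; apply: nearW => h /=.
    by rewrite mulNr mulrAC.
  apply: cvgM; first exact: cz.
  apply: cvgD; first exact: cvg_cst.
  have := crhoc (2 * z).
  rewrite expr0n mulr0 mul0r addr0; apply: cvg_trans; apply: near_eq_cvg; apply: nearW => h /=.
  by rewrite mulrAC.
apply: cvg_trans cG; apply: near_eq_cvg; near=> h.
have h0 : h != 0 by near: h; exact: nbhs_dnbhs_neq.
rewrite /G mulr_sumr; apply: eq_bigr => i _ /=.
by rewrite !Ef; field.
Unshelve. all: end_near. Qed.

End Laplacian.

(** * Power series of exponential type *)

Section ExponentialType.
Context {R : realType}.
Implicit Types (c : nat -> R) (x t : R).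

(** Domination by the coefficients of C exp (r t): enough for convergence
    everywhere, and stable under differentiation and under the Laplacian. *)
Definition exp_type c : Prop :=
  exists C r : R, [/\ 0 <= C, 0 <= r & forall j, `|c j| <= C * (r ^+ j / j`!%:R)].

Definition psum c x : R := limn (pseries c x).

Lemma exp_type_norm c : exp_type c -> exp_type (fun j => `|c j|).
Proof. by move=> [C [r [C0 r0 H]]]; exists C, r; split=> // j; rewrite normr_id. Qed.

Lemma exp_type_le c b : exp_type b -> (forall j, `|c j| <= `|b j|) -> exp_type c.
Proof.
by move=> [C [r [C0 r0 H]]] cb; exists C, r; split=> // j; exact: le_trans (cb j) (H j).
Qed.

Lemma exp_type_scale k c : exp_type c -> exp_type (fun j => k * c j).
Proof.
move=> [C [r [C0 r0 H]]]; exists (`|k| * C), r; split=> //; first exact: mulr_ge0.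
by move=> j; rewrite normrM -mulrA ler_wpM2l.
Qed.

Lemma exp_type_cvg c x : exp_type c -> cvgn (pseries c x).
Proof.
move=> [C [r [C0 r0 H]]]; apply: normed_cvg.
apply: (@series_le_cvg _ _ (fun j => C * exp_coeff (r * `|x|) j)).
- by move=> j; rewrite normr_ge0.
- by move=> j; rewrite mulr_ge0// exp_coeff_ge0// mulr_ge0.
- move=> j; rewrite /= normrM normrX /exp_coeff /= exprMn.
  by rewrite (_ : _ * (_ / _) = C * (r ^+ j / j`!%:R) * `|x| ^+ j); [rewrite ler_wpM2r ?exprn_ge0|ring].
have -> : series (fun j => C * exp_coeff (r * `|x|) j) =
    (fun m => C * series (exp_coeff (r * `|x|)) m).
  by apply/funext => m; rewrite /series /= mulr_sumr.
by apply: is_cvgMl_tmp; exact: is_cvg_series_exp_coeff.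
Qed.

Lemma psumZ k c x : psum (fun j => k * c j) x = k * psum c x.
Proof.
rewrite /psum -limnMl_total; congr (lim (_ @ \oo)); apply/funext => m.
by rewrite /pseries /series /= mulr_sumr; apply: eq_bigr => j _; rewrite mulrA.
Qed.

Lemma exp_type_diffs c : exp_type c -> exp_type (pseries_diffs c).
Proof.
move=> [C [r [C0 r0 H]]]; exists (C * r), r; split=> //; first exact: mulr_ge0.
move=> j; rewrite /pseries_diffs normrM ger0_norm//.
apply: (le_trans (ler_wpM2l _ (H j.+1))) => //.
rewrite factS natrM exprS le_eqVlt; apply/orP; left; apply/eqP; field.
by rewrite addrC natr1 !pnatr_eq0 -lt0n fact_gt0.
Qed.

Lemma is_derive_psum c x : exp_type c ->
  is_derive x (1:R) (psum c) (psum (pseries_diffs c) x).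
Proof.
move=> ec; apply: (@pseries_snd_diffs _ _ (`|x| + 1)).
- exact: exp_type_cvg.
- exact/exp_type_cvg/exp_type_diffs.
- exact/exp_type_cvg/exp_type_diffs/exp_type_diffs.
- by rewrite [ltRHS]ger0_norm ?ltrDl// addr_ge0.
Qed.

(** Coefficients of -(4 t f'' + 2 n f') when f has the coefficients [c]. *)
Definition lapl_coeff n c (j : nat) : R :=
  - ((4 * j%:R + 2 * n%:R) * (j.+1%:R * c j.+1)).

Lemma exp_type_lapl n c : exp_type c -> exp_type (lapl_coeff n c).
Proof.
move=> /exp_type_diffs[C [r [C0 r0 H]]].
exists ((4 + 2 * n%:R) * C), (2 * r); split.
- by rewrite mulr_ge0// ?addr_ge0 ?mulr_ge0.
- by rewrite mulr_ge0 ?ler0n.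
move=> j; rewrite /lapl_coeff normrN -/(pseries_diffs c j) normrM.
rewrite exprMn ger0_norm ?addr_ge0 ?mulr_ge0//.
rewrite [leRHS](_ : _ = (4 + 2 * n%:R) * 2 ^+ j * (C * (r ^+ j / j`!%:R))); last by ring.
apply: ler_pM => //.
have h1 : (1:R) <= 2 ^+ j by rewrite exprn_ege1// ler1n.
have h2 : (j%:R : R) <= 2 ^+ j by rewrite -natrX ler_nat ltnW// ltn_expl.
rewrite [leRHS]mulrDl; apply: lerD; first by rewrite ler_pM2l.
by rewrite ler_peMr ?mulr_ge0.
Qed.

Lemma psum_lapl n c t : exp_type c ->
  - (4 * t * psum (pseries_diffs (pseries_diffs c)) t
     + 2 * n%:R * psum (pseries_diffs c) t) = psum (lapl_coeff n c) t.
Proof.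
move=> ec; have ec1 := exp_type_diffs ec; have ec2 := exp_type_diffs ec1.
apply/esym/cvg_lim => //.
have h2 := pseries_diffs_equiv (@exp_type_cvg _ t ec2).
have h1 : pseries (pseries_diffs c) t @ \oo --> psum (pseries_diffs c) t.
  exact: exp_type_cvg.
rewrite (_ : pseries _ t = fun m => - (4 * t *
    [series i%:R * pseries_diffs c i * t ^+ i.-1]_i m
    + 2 * n%:R * pseries (pseries_diffs c) t m)).
  by apply: cvgN; apply: cvgD; apply: cvgMl_tmp.
apply/funext => m.
rewrite /pseries /series /= !mulr_sumr -big_split /= -sumrN.
apply: eq_bigr => -[|j] _; rewrite /lapl_coeff /pseries_diffs /=.
  by ring.
by rewrite exprS; ring.
Qed.

Lemma radial_psd_lapl n c : exp_type c ->
  radial_psd n (psum c) -> radial_psd n (psum (lapl_coeff n c)).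
Proof.
move=> ec pc; have := radial_psd_laplacian (fun x => is_derive_psum x ec)
  (fun x => is_derive_psum x (exp_type_diffs ec)) pc.
by apply: psd_ext => x y; rewrite psum_lapl.
Qed.

Lemma psum_dist_le c b (B : R) x : exp_type c -> exp_type b ->
  (forall m, `|pseries c x m - pseries b x m| <= B) ->
  `|psum c x - psum b x| <= B.
Proof.
move=> ec eb H.
have h : `|pseries c x m - pseries b x m| @[m --> \oo] --> `|psum c x - psum b x|.
  by apply: cvg_norm; apply: cvgB; exact: exp_type_cvg.
by apply: (cvgr_to_le h); exact: nearW.
Qed.

End ExponentialType.

(** * Approximation of the Schoenberg kernel *)

Section SchoenbergKernel.
Context {R : realType}.
Implicit Types (a e t : R).

(** The Pochhammer symbol (rising factorial). *)
Definition poch a (j : nat) : R := \prod_(i < j) (a + i%:R).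
(** Coefficients of Omega_n as a power series in |x|^2, for a = n/2. *)
Definition omega a (j : nat) : R := (-1) ^+ j / (4 ^+ j * j`!%:R * poch a j).

Lemma pochS a j : poch a j.+1 = poch a j * (a + j%:R).
Proof. by rewrite /poch big_ord_recr. Qed.

Lemma poch_gt0 a j : 0 < a -> 0 < poch a j.
Proof. by move=> a0; apply: prodr_gt0 => i _; rewrite ltr_wpDr. Qed.

Lemma poch_neq0 a j : 0 < a -> poch a j != 0.
Proof. by move=> a0; rewrite gt_eqF// poch_gt0. Qed.

Lemma natr_fact_neq0 j : (j`!%:R : R) != 0.
Proof. by rewrite pnatr_eq0 -lt0n fact_gt0. Qed.

Lemma pochD a d j : poch a (j + d) = poch a d * poch (a + d%:R) j.
Proof.
elim: j => [|j IH]; first by rewrite /poch [in RHS]big_ord0 mulr1.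
by rewrite addSn !pochS IH natrD -mulrA addrAC -addrA addrA addrAC.
Qed.

(** For [d = 0] the series is exp (- e t / 4), and one Laplacian increments [d]
    because it acts as a backward shift in the basis omega_j t^j. *)
Lemma gauss_laplacians n e d : (0 < n)%N -> 0 <= e ->
  let c := fun j => omega (n%:R / 2) j * (e ^+ (j + d) * poch (n%:R / 2) (j + d)) in
  exp_type c /\ radial_psd n (psum c).
Proof.
move=> n0 e0; set a : R := n%:R / 2.
have a0 : 0 < a by rewrite divr_gt0// ltr0n.
elim: d => [|d [ec pc]].
  have E : (fun j => omega a j * (e ^+ (j + 0) * poch a (j + 0))) =
      (fun j => (- (e / 4)) ^+ j / j`!%:R).
    apply/funext => j; rewrite addn0 /omega [in RHS]exprNn expr_div_n; field.
    by rewrite natr_fact_neq0 poch_neq0// expf_neq0.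
  rewrite E; split.
    exists 1, (e / 4); split=> //; first by rewrite divr_ge0.
    move=> j; rewrite mul1r normrM normrX normrN !ger0_norm ?divr_ge0//.
  have := @radial_psd_gauss R n (e / 4) (divr_ge0 e0 (ler0n _ 4)).
  apply: psd_ext => x y; rewrite /expR /psum; congr (lim (_ @ \oo)).
  apply/funext => m; rewrite /pseries /series /=; apply: eq_bigr => j _.
  by rewrite /exp_coeff /= -mulNr exprMn mulrAC.
have E : (fun j => omega a j * (e ^+ (j + d.+1) * poch a (j + d.+1))) =
    lapl_coeff n (fun j => omega a j * (e ^+ (j + d) * poch a (j + d))).
  apply/funext => j; rewrite /lapl_coeff addSnnS /omega pochS factS natrM !exprS.
  have -> : (n%:R : R) = 2 * a by rewrite /a; field.
  field.
  by rewrite gt_eqF ?ltr_wpDr// poch_neq0// natr_fact_neq0 addrC natr1 pnatr_eq0 expf_neq0.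
by rewrite E; split; [exact: exp_type_lapl|exact: radial_psd_lapl].
Qed.

(** Ratio between the coefficients of the normalised [d.+1]-st Laplacian of
    the Gaussian exp (- t / (4 (d+1))) and those of Omega_n. *)
Definition beta a (d j : nat) : R := \prod_(i < j) (1 + (a + i%:R) / d.+1%:R).

Lemma betaS a d j : beta a d j.+1 = beta a d j * (1 + (a + j%:R) / d.+1%:R).
Proof. by rewrite /beta big_ord_recr. Qed.

Lemma beta_ge1 a d j : 0 <= a -> 1 <= beta a d j.
Proof.
move=> a0; elim: j => [|j IH]; first by rewrite /beta big_ord0.
by rewrite betaS mulr_ege1// lerDl divr_ge0// addr_ge0.
Qed.

(** As a polynomial in k = 1/(d+1), the product minus 1 has nonnegative
    coefficients and no constant term, so on [0, 1] it is at most k times its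
    value at k = 1, which is the case [d = 0]. *)
Lemma beta_le a d j : 0 <= a -> beta a d j - 1 <= (beta a 0 j - 1) / d.+1%:R.
Proof.
move=> a0; elim: j => [|j IH]; first by rewrite /beta !big_ord0 subrr mul0r.
rewrite !betaS divr1; set u := a + j%:R.
have u0 : 0 <= u by rewrite addr_ge0.
move: IH; have := @beta_ge1 a 0 j a0; move: (beta a 0 j) (beta a d j) => B b B1 IH.
set k : R := d.+1%:R^-1; rewrite -/k in IH.
have k0 : 0 <= k by rewrite invr_ge0.
have k1 : k <= 1 by rewrite invf_le1 ?ler1n// ltr0n.
have h1 : b * (1 + u * k) <= (1 + (B - 1) * k) * (1 + u * k).
  by rewrite ler_wpM2r ?addr_ge0 ?mulr_ge0//; lra.
have h2 : (B - 1) * u * k * k <= (B - 1) * u * k.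
  by rewrite ler_piMr// !mulr_ge0// subr_ge0.
nra.
Qed.

Lemma poch_beta a d j :
  d.+1%:R^-1 ^+ (j + d.+1) * poch a (j + d.+1) =
  (d.+1%:R^-1 ^+ d.+1 * poch a d.+1) * beta a d j.
Proof.
rewrite pochD exprD.
suff -> : poch (a + d.+1%:R) j = d.+1%:R ^+ j * beta a d j.
  by rewrite exprVn; field; rewrite !expf_neq0// addrC natr1 pnatr_eq0.
rewrite /poch /beta -[in d.+1%:R ^+ j](card_ord j) -prodr_const -big_split /=.
by apply: eq_bigr => i _; field; rewrite addrC natr1 pnatr_eq0.
Qed.

Lemma radial_psd_beta n d : (0 < n)%N ->
  let c := fun j => omega (n%:R / 2) j * beta (n%:R / 2) d j in
  exp_type c /\ radial_psd n (psum c).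
Proof.
move=> n0; set a : R := n%:R / 2.
have a0 : 0 < a by rewrite divr_gt0// ltr0n.
have d0 : 0 <= (d.+1%:R^-1 : R) by rewrite invr_ge0.
have [ec pc] := gauss_laplacians d.+1 n0 d0.
set K := d.+1%:R^-1 ^+ d.+1 * poch a d.+1.
have K0 : 0 < K by rewrite mulr_gt0 ?poch_gt0// exprn_gt0// invr_gt0 ltr0n.
have E : (fun j => omega a j * beta a d j) = (fun j => K^-1 *
  (omega a j * (d.+1%:R^-1 ^+ (j + d.+1) * poch a (j + d.+1)))).
  apply/funext => j; rewrite poch_beta -/K.
  by field; rewrite gt_eqF.
rewrite E; split; first exact: exp_type_scale.
have Ki : 0 <= K^-1 by rewrite invr_ge0 ltW.
by have := psd_scale Ki pc; apply: psd_ext => x y; rewrite psumZ.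
Qed.

Lemma exp_type_omega n : (0 < n)%N -> exp_type (omega (n%:R / 2)).
Proof.
move=> n0; have [e0 _] := radial_psd_beta 0 n0.
apply: (exp_type_le e0) => j /=; rewrite [leRHS]normrM ler_peMr//.
by rewrite (le_trans _ (ler_norm _))// beta_ge1// divr_ge0.
Qed.

(** Dominated convergence: by [beta_le] the distance to the limit is at most
    1/(d+1) times the convergent series with coefficients |b 0 j|. *)
Lemma radial_psd_omega n : (0 < n)%N -> radial_psd n (psum (omega (n%:R / 2))).
Proof.
move=> n0; set a : R := n%:R / 2.
have a0 : 0 <= a by rewrite divr_ge0.
pose b d j := omega a j * beta a d j.
have eb d : exp_type (b d) by have [] := radial_psd_beta d n0.
apply: (@psd_lim _ nat _ \oo _ (fun d x y => psum (b d) (sqnorm (x - y)))).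
  by apply: nearW => d; have [] := radial_psd_beta d n0.
move=> x y; set t := sqnorm (x - y).
pose M := psum (fun j => `|b 0 j|) `|t|.
have bound d : `|psum (b d) t - psum (omega a) t| <= M * d.+1%:R^-1.
  apply: psum_dist_le => //; first exact: exp_type_omega.
  move=> m; rewrite /pseries /series /= -sumrB.
  apply: (le_trans (ler_norm_sum _ _ _)).
  apply: (@le_trans _ _ ((\sum_(0 <= j < m) `|b 0 j| * `|t| ^+ j) * d.+1%:R^-1)).
    rewrite mulr_suml; apply: ler_sum => j _; rewrite /b.
    rewrite (_ : _ - _ = omega a j * t ^+ j * (beta a d j - 1)); last by ring.
    rewrite [leRHS](_ : _ = `|omega a j * t ^+ j| * (`|beta a 0 j| / d.+1%:R)); last first.
      by rewrite -normrX !normrM; ring.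
    rewrite normrM ler_wpM2l//.
    rewrite ger0_norm ?subr_ge0 ?beta_ge1//; apply: le_trans (beta_le _ _ a0) _.
    by rewrite ler_wpM2r ?invr_ge0// ger0_norm; [lra|exact: le_trans (beta_ge1 _ _ a0)].
  rewrite ler_wpM2r ?invr_ge0//.
  apply: (@nondecreasing_cvgn_le _ (pseries (fun j => `|b 0 j|) `|t|)).
    by apply: nondecreasing_series => j _ _; rewrite mulr_ge0// exprn_ge0.
  by apply: exp_type_cvg; exact: exp_type_norm.
have Mh : M * harmonic d @[d --> \oo] --> M * 0.
  by apply: cvgMl_tmp; exact: cvg_harmonic.
apply/cvgrPdist_le => e e0; move/cvgrPdist_le: Mh => /(_ e e0).
apply: filterS => d; rewrite mulr0 sub0r normrN distrC.
by apply: le_trans; apply: le_trans (bound d) (ler_norm _).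
Qed.

End SchoenbergKernel.

(** * The fourth order necessary condition *)

Section FourthOrder.
Context {R : realType}.

(** Real weights carried by an arbitrary finite type of distinct points. *)
Lemma Phi_real_quad n (f : R -> R) (T : finType) (x : T -> 'rV[R]_n) (w : T -> R) :
  Phi n f -> injective x ->
  0 <= \sum_(s : T) \sum_(t : T) f (enorm (x s - x t)) * (w s * w t).
Proof.
move=> [_ pf] xinj.
have := pf #|T| (x \o enum_val) (fun j => ((w (enum_val j))%:C)%C)
  (inj_comp xinj enum_val_inj).
move=> H; rewrite -lecR; apply: (le_trans H); rewrite le_eqVlt; apply/orP; left; apply/eqP.
rewrite rmorph_sum [RHS](reindex _ (onW_bij _ (@enum_val_bij T))).
apply: eq_bigr => k _.
rewrite rmorph_sum [RHS](reindex _ (onW_bij _ (@enum_val_bij T))).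
apply: eq_bigr => j _.
by rewrite conjc_real !rmorphM /= -mulrA [X in _ * X]mulrC.
Qed.

(** The stencil of the discrete Laplacian: the origin and the points +h e_i and
    -h e_i. *)
Definition cross_point n (h : R) (s : unit + 'I_n * bool) : 'rV[R]_n :=
  match s with inl _ => 0 | inr (i, b) => ((-1) ^+ b * h) *: delta_mx ord0 i end.

(** Squared distances within the stencil, in units of h^2. *)
Definition cross_dist n (s t : unit + 'I_n * bool) : nat :=
  match s, t with
  | inl _, inl _ => 0
  | inr (i, b), inr (j, c) => if i == j then (if b == c then 0 else 4) else 2
  | _, _ => 1
  end%N.

Lemma sqnorm_cross n h (s t : unit + 'I_n * bool) :
  sqnorm (cross_point h s - cross_point h t) = (cross_dist s t)%:R * h ^+ 2.
Proof.
have d1 (k : R) i : sqnorm (k *: delta_mx ord0 i : 'rV[R]_n) = k ^+ 2.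
  rewrite /sqnorm (bigD1 i)//= big1 ?addr0 => [|j ji]; rewrite !mxE eqxx /=.
    by rewrite eqxx mulr1.
  by rewrite (negbTE ji) mulr0 expr0n.
have d2 (k l : R) i j : i != j ->
    sqnorm (k *: delta_mx ord0 i - l *: delta_mx ord0 j : 'rV[R]_n) = k ^+ 2 + l ^+ 2.
  move=> ij; rewrite sqnormB !d1 /dot big1 ?mulr0 ?subr0// => m _.
  rewrite !mxE eqxx /=; have [->|mi] := eqVneq m i; last by rewrite mulr0 mul0r.
  by rewrite (negbTE ij) !mulr0.
have sq b : ((-1) ^+ (b : bool) * h) ^+ 2 = h ^+ 2 by rewrite exprMn sqrr_sign mul1r.
case: s t => [[]|[i b]] [[]|[j c]] /=.
- by rewrite subrr /sqnorm big1 ?mul0r// => i _; rewrite mxE expr0n.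
- by rewrite sub0r -scaleNr d1 sqrrN sq mul1r.
- by rewrite subr0 d1 sq mul1r.
have [->|ij] := eqVneq i j; last by rewrite d2// !sq; ring.
by rewrite -scalerBl d1; case: b c => [] []; rewrite /= ?expr0 ?expr1; ring.
Qed.

Lemma cross_point_inj n h : 0 < h -> injective (@cross_point n h).
Proof.
move=> h0 s t st; have := sqnorm_cross h s t; rewrite st subrr /sqnorm big1; last first.
  by move=> i _; rewrite mxE expr0n.
move/esym/eqP; rewrite mulf_eq0 expf_eq0 /= (gt_eqF h0) orbF pnatr_eq0.
case: s t {st} => [[]|[i b]] [[]|[j c]] //=.
by have [->|//] := eqVneq i j; have [->|//] := eqVneq b c.
Qed.

(** The quadratic form of the stencil, with weight [w] at the origin and 1 at the
    other points: each of the 2n outer points is at distance 2h from one outer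
    point and at distance sqrt 2 * h from 2(n-1) of them. *)
Lemma Phi_cross n (f : R -> R) (h w : R) : Phi n f -> 0 < h ->
  0 <= w ^+ 2 * f 0 + 4 * n%:R * w * f h
     + 2 * n%:R * (f 0 + f (2 * h) + 2 * (n%:R - 1) * f (Num.sqrt 2 * h)).
Proof.
move=> pf h0; pose phi (k : nat) := f (Num.sqrt (k%:R * h ^+ 2)).
have phiE k : phi k = f (Num.sqrt k%:R * h).
  by rewrite /phi sqrtrM// sqrtr_sqr gtr0_norm.
have -> : f 0 = phi 0%N by rewrite phiE sqrtr0 mul0r.
have -> : f h = phi 1%N by rewrite phiE sqrtr1 mul1r.
have -> : f (2 * h) = phi 4%N.
  by rewrite phiE (_ : 4%:R = 2 ^+ 2) ?sqrtr_sqr ?ger0_norm// -natrX.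
rewrite -phiE.
pose wt (s : unit + 'I_n * bool) : R := if s is inl _ then w else 1.
have := Phi_real_quad wt pf (cross_point_inj h0).
move=> H; apply: (le_trans H); rewrite le_eqVlt; apply/orP; left; apply/eqP.
transitivity (\sum_(s : unit + 'I_n * bool) \sum_(t : unit + 'I_n * bool)
   phi (cross_dist s t) * (wt s * wt t)).
  apply: eq_bigr => s _; apply: eq_bigr => t _.
  by rewrite /enorm -/(sqnorm _) sqnorm_cross.
have unit1 (g : unit -> R) : \sum_(u : unit) g u = g tt.
  by rewrite (bigD1 tt)//= big1 ?addr0// => -[].
have pairs (g : 'I_n * bool -> R) :
    \sum_p g p = \sum_i (g (i, true) + g (i, false)).
  rewrite (eq_bigr (fun p => g (p.1, p.2))) => [|[]//].
  rewrite -(pair_bigA _ (fun i b => g (i, b))) /=.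
  by apply: eq_bigr => i _; rewrite big_bool.
have const (k : R) : \sum_(i < n) k = n%:R * k.
  by rewrite sumr_const card_ord mulr_natl.
rewrite big_sumType /= unit1 big_sumType /= unit1 !pairs /= !const.
have row i b : \sum_(t : unit + 'I_n * bool) phi (cross_dist (inr (i, b)) t) *
      (wt (inr (i, b)) * wt t) =
    w * phi 1%N + (phi 0%N + phi 4%N + 2 * (n%:R - 1) * phi 2%N).
  rewrite big_sumType /= unit1 pairs /= (bigD1 i)//= eqxx.
  rewrite (eq_bigr (fun=> 2 * phi 2%N)); last first.
    by move=> j ji; rewrite eq_sym (negbTE ji) !mulr1; ring.
  have n1 : (n.-1%:R : R) = n%:R - 1.
    by case: n i {H pf wt pairs const} => [[]//|m _] /=; rewrite -natr1 addrK.
  by rewrite sumr_const cardC1 card_ord -[_ *+ n.-1]mulr_natl n1; case: b => /=; ring.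
rewrite (eq_bigr (fun=> 2 * (w * phi 1%N +
  (phi 0%N + phi 4%N + 2 * (n%:R - 1) * phi 2%N)))); last first.
  by move=> i _; rewrite !row; ring.
by rewrite const; ring.
Qed.

(** The weight w = 2 n a1 h^2 - 2 n at the origin discretises Laplacian + c for
    the value c = 2 n a1 that minimises the quadratic polynomial
    (Laplacian + c)^2 F (0).  With this choice the terms of order 0 and 2 in h
    cancel, and the term of order 4 is 4 n ((2n+4) a2 - n a1^2) h^4. *)
Lemma fourth_order_necessary n (f : R -> R) (a1 a2 C delta : R) :
  (0 < n)%N -> 0 < delta -> 0 <= C ->
  (forall z, 0 <= z < delta ->
     `|f z - (1 - a1 * z ^+ 2 + a2 * z ^+ 4)| <= C * z ^+ 6) ->
  Phi n f -> n%:R * a1 ^+ 2 <= (2 * n%:R + 4) * a2.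
Proof.
move=> n0 d0 C0 taylor pf; rewrite leNgt; apply/negP => lt_a.
have N0 : (0:R) < n%:R by rewrite ltr0n.
have N1 : (1:R) <= n%:R by rewrite ler1n.
set N : R := n%:R in lt_a N0 N1.
pose K := 4 * N * (N * a1 ^+ 2 - (2 * N + 4) * a2).
have K0 : 0 < K by rewrite !mulr_gt0// subr_gt0.
(* E h^6 bounds what is left beyond order 4: the Taylor remainders and the
   product of the h^2 term of the weight with the h^4 term of f h. *)
pose E := C * (4 * N * (2 * N * `|a1| + 2 * N) + 128 * N + 32 * N * (N - 1))
  + 8 * N ^+ 2 * `|a1 * a2|.
have E0 : 0 <= E.
  apply: addr_ge0; last by rewrite !mulr_ge0 ?sqr_ge0.
  apply: mulr_ge0 => //.
  have h1 : 0 <= N * (N * `|a1|) by rewrite !mulr_ge0// ltW.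
  have h2 : 0 <= N * (N - 1) by rewrite mulr_ge0 ?subr_ge0// ltW.
  by nra.
have [h [h0 h1 hd hE]] : exists h, [/\ 0 < h, h <= 1, 2 * h < delta & E * h < K].
  (* These bounds give 2 h < delta and E h < K, hence E h^6 < K h^4. *)
  exists (Num.min 1 (Num.min (delta / 4) (K / (E + 1) / 2))).
  have E1 : 0 < E + 1 by lra.
  set h := Num.min _ _; have : h <= Num.min (delta / 4) (K / (E + 1) / 2).
    by rewrite ge_min lexx orbT.
  rewrite le_min => /andP[hd hK]; split.
  - by rewrite !lt_min ltr01 !divr_gt0.
  - by rewrite ge_min lexx.
  - lra.
  - have : E * h <= E * (K / (E + 1) / 2) by rewrite ler_wpM2l.
    move=> /le_lt_trans; apply.
    rewrite [ltLHS](_ : _ = K * (E / (E + 1) / 2)); last by ring.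
    rewrite gtr_pMr// ltr_pdivrMr// mul1r ltr_pdivrMr//; lra.
have := @Phi_cross n f h (2 * N * a1 * h ^+ 2 - 2 * N) pf h0.
rewrite -/N.
have s2 : (Num.sqrt 2 : R) ^+ 2 = 2 by rewrite sqr_sqrtr.
have s20 : 0 <= (Num.sqrt 2 : R) by exact: sqrtr_ge0.
have s22 : (Num.sqrt 2 : R) <= 2 by rewrite -(@ler_pXn2r _ 2)// ?nnegrE// s2; lra.
set s := Num.sqrt 2 in s2 s20 s22 *.
have f0 : f 0 = 1.
  have := taylor 0; rewrite lexx d0 => /(_ isT).
  by rewrite !expr0n /= !mulr0 subr0 addr0 normr_le0 subr_eq0 => /eqP.
have T1 := taylor h; have T2 := taylor (2 * h); have T3 := taylor (s * h).
have {}T1 : `|f h - (1 - a1 * h ^+ 2 + a2 * h ^+ 4)| <= C * h ^+ 6.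
  by apply: T1; lra.
have {}T2 : `|f (2 * h) - (1 - 4 * a1 * h ^+ 2 + 16 * a2 * h ^+ 4)| <= 64 * C * h ^+ 6.
  rewrite (_ : 1 - _ + _ = 1 - a1 * (2 * h) ^+ 2 + a2 * (2 * h) ^+ 4); last by ring.
  rewrite (_ : 64 * C * h ^+ 6 = C * (2 * h) ^+ 6); last by ring.
  by apply: T2; lra.
have s4 : s ^+ 4 = 4 by rewrite (exprM s 2 2) s2; ring.
have s6 : s ^+ 6 = 8 by rewrite (exprM s 2 3) s2; ring.
have {}T3 : `|f (s * h) - (1 - 2 * a1 * h ^+ 2 + 4 * a2 * h ^+ 4)| <= 8 * C * h ^+ 6.
  rewrite (_ : 1 - _ + _ = 1 - a1 * (s * h) ^+ 2 + a2 * (s * h) ^+ 4); last first.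
    by rewrite !exprMn s2 s4; ring.
  rewrite (_ : 8 * C * h ^+ 6 = C * (s * h) ^+ 6); last by rewrite exprMn s6; ring.
  apply: T3; rewrite mulr_ge0 ?(ltW h0)//=; apply: le_lt_trans hd.
  by rewrite ler_wpM2r// ltW.
move: T1 T2 T3; set e1 := f h - _; set e2 := f (2 * h) - _; set e3 := f (s * h) - _.
move=> T1 T2 T3; rewrite f0.
pose w := 2 * N * a1 * h ^+ 2 - 2 * N.
rewrite [X in 0 <= X](_ : _ = - K * h ^+ 4 +
   (4 * N * w * e1 + 2 * N * e2 + 4 * N * (N - 1) * e3
    + 8 * N ^+ 2 * (a1 * a2) * h ^+ 6)); last first.
  by rewrite /K /w /e1 /e2 /e3; ring.
apply/negP; rewrite -ltNge.
have hh : h ^+ 2 <= 1 by rewrite expr_le1// ltW.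
have hp : 0 < h ^+ 4 by rewrite exprn_gt0.
have wle : `|w| <= 2 * N * `|a1| + 2 * N.
  rewrite /w; apply: (le_trans (ler_normB _ _)).
  rewrite (ger0_norm (_ : 0 <= 2 * N)) ?mulr_ge0 ?(ltW N0)// lerD2r.
  rewrite normrM (ger0_norm (sqr_ge0 h)) normrM ger0_norm ?mulr_ge0 ?(ltW N0)//.
  by rewrite ler_piMr// !mulr_ge0// ltW.
have B1 : 4 * N * w * e1 <= 4 * N * (2 * N * `|a1| + 2 * N) * (C * h ^+ 6).
  apply: (le_trans (ler_norm _)); rewrite normrM; apply: ler_pM => //.
  by rewrite normrM ger0_norm ?ler_wpM2l// mulr_ge0// ltW.
have B2 : 2 * N * e2 <= 2 * N * (64 * C * h ^+ 6).
  by rewrite ler_wpM2l ?mulr_ge0 ?(ltW N0)//; apply: le_trans (ler_norm _) T2.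
have B3 : 4 * N * (N - 1) * e3 <= 4 * N * (N - 1) * (8 * C * h ^+ 6).
  rewrite ler_wpM2l ?mulr_ge0 ?(ltW N0) ?subr_ge0//.
  by apply: le_trans (ler_norm _) T3.
have B5 : 8 * N ^+ 2 * (a1 * a2) * h ^+ 6 <= 8 * N ^+ 2 * `|a1 * a2| * h ^+ 6.
  by rewrite ler_wpM2r ?exprn_ge0 ?(ltW h0)// ler_wpM2l ?ler_norm// mulr_ge0 ?sqr_ge0.
have B4 : E * h ^+ 6 < K * h ^+ 4.
  rewrite (_ : E * h ^+ 6 = E * h * h * h ^+ 4); last by ring.
  rewrite ltr_pM2r//; apply: le_lt_trans hE; rewrite ler_piMr// mulr_ge0//.
  exact: ltW.
apply: (@le_lt_trans _ _ (- K * h ^+ 4 + E * h ^+ 6)); last by rewrite mulNr addrC subr_lt0.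
rewrite lerD2l; apply: (le_trans (lerD (lerD (lerD B1 B2) B3) B5)).
by rewrite le_eqVlt; apply/orP; left; apply/eqP; rewrite /E; ring.
Qed.

(** The terms at z0 are bounded, since the series converges there; for z <= z0/2
    the tail of the series is then dominated by a geometric series of ratio
    (z/z0)^2 <= 1/2. *)
Lemma taylor4_of_series (f : R -> R) (a : nat -> R) (delta : R) : 0 < delta ->
  (forall z : R, 0 <= z < delta ->
     series (fun j : nat => (-1) ^+ j * a j * z ^+ (2 * j)) @ \oo --> f z) ->
  exists C d : R, [/\ 0 <= C, 0 < d & forall z, 0 <= z < d ->
     `|f z - (a 0%N - a 1%N * z ^+ 2 + a 2%N * z ^+ 4)| <= C * z ^+ 6].
Proof.
move=> d0 cv; set z0 := delta / 2.
have z00 : 0 < z0 by rewrite divr_gt0.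
have z0d : 0 <= z0 < delta by rewrite (ltW z00) /z0; lra.
clearbody z0.
have [M [M0 HM]] : exists M, 0 <= M /\ forall j, `|a j| * z0 ^+ (2 * j) <= M.
  have [K [_ Kf]] := cvg_series_bounded (cvgP _ (cv z0 z0d)).
  exists (`|K| + 1); split; first by rewrite addr_ge0.
  move=> j; have := Kf (`|K| + 1) _ j I.
  rewrite (le_lt_trans (ler_norm K)) ?ltrDl// => /(_ isT).
  by rewrite /= -mulrA normrMsign normrM [X in _ * X]ger0_norm// exprn_ge0// ltW.
exists (2 * M / z0 ^+ 6), (z0 / 2); split.
- by rewrite !mulr_ge0// invr_ge0 exprn_ge0// ltW.
- by rewrite divr_gt0.
move=> z /andP[zge zlt].
pose q := (z / z0) ^+ 2.
have q0 : 0 <= q by rewrite sqr_ge0.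
have q2 : 2 * q <= 1.
  have h0 : 0 <= z / z0 by rewrite divr_ge0// ltW.
  have h1 : z / z0 <= 1 / 2 by rewrite ler_pdivrMr// mulrC mul1r ltW// mulrC.
  by rewrite /q expr2; nra.
have zd : 0 <= z < delta by rewrite zge /=; case/andP: z0d => _; lra.
have geom m : \sum_(0 <= i < m) q ^+ i.+3 <= 2 * q ^+ 3 - 2 * q ^+ m.+3.
  elim: m => [|m IH]; first by rewrite big_geq// subrr.
  rewrite big_nat_recr//= [q ^+ m.+4]exprS.
  have : 2 * q * q ^+ m.+3 <= 1 * q ^+ m.+3 by rewrite ler_wpM2r// exprn_ge0.
  by lra.
have -> : 2 * M / z0 ^+ 6 * z ^+ 6 = M * (2 * q ^+ 3).
  by rewrite /q -exprM -[(2 * 3)%N]/6%N expr_div_n; field; rewrite gt_eqF.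
have := cv z zd; rewrite -(cvg_shiftn 3) => c3.
have c4 : `|series (fun j : nat => (-1) ^+ j * a j * z ^+ (2 * j)) (m + 3)%N
    - (a 0%N - a 1%N * z ^+ 2 + a 2%N * z ^+ 4)| @[m --> \oo] -->
    `|f z - (a 0%N - a 1%N * z ^+ 2 + a 2%N * z ^+ 4)|.
  by apply: cvg_norm; apply: cvgB => //; exact: cvg_cst.
apply: (cvgr_to_le c4); apply: nearW => m.
rewrite addn3 /series /= big_nat_recl// big_nat_recl// big_nat_recl//=.
rewrite (_ : _ - _ = \sum_(0 <= i < m) (-1) ^+ i.+3 * a i.+3 * z ^+ (2 * i.+3)); last first.
  by rewrite !muln0 !expr0 expr1 !muln1 -!addrA; ring.
apply: (le_trans (ler_norm_sum _ _ _)).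
apply: (@le_trans _ _ (\sum_(0 <= i < m) M * q ^+ i.+3)).
  apply: ler_sum => i _; rewrite -mulrA normrMsign normrM.
  rewrite [X in _ * X]ger0_norm ?exprn_ge0//.
  have -> : z ^+ (2 * i.+3) = z0 ^+ (2 * i.+3) * q ^+ i.+3.
    by rewrite /q -exprM -exprMn mulrC divfK// gt_eqF.
  by rewrite mulrA; apply: ler_wpM2r; [exact: exprn_ge0|exact: HM].
rewrite -mulr_sumr ler_wpM2l//; apply: le_trans (geom m) _.
by rewrite gerBl mulr_ge0// exprn_ge0.
Qed.

End FourthOrder.

(** * The Gamma function *)

Section GammaFunction.
Context {R : realType}.
Local Notation mu := (@lebesgue_measure R).

Definition gamma_density (x t : R) : R := t `^ (x - 1) * expR (- t).

(** Extended real valued, so that the functional equation can be proved before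
    the integral is known to be finite. *)
Definition egamma (x : R) : \bar R :=
  (\int[mu]_(t in `]0%R, +oo[) (gamma_density x t)%:E)%E.

Lemma gamma_density_ge0 x t : 0 <= gamma_density x t.
Proof. by rewrite mulr_ge0 ?powR_ge0 ?expR_ge0. Qed.

Lemma measurable_gamma_density x (D : set R) : measurable_fun D (gamma_density x).
Proof.
apply: measurable_funTS; apply: measurable_funM.
  exact: measurable_powR.
by apply: measurableT_comp; [exact: measurable_expR|exact: oppr_measurable].
Qed.

Lemma is_derive_expRN (t : R) :
  is_derive t (1:R) (fun s : R => expR (- s)) (- expR (- t)).
Proof.
rewrite -mulrN1.
exact: (@is_derive1_comp _ expR -%R t _ _ (is_derive_expR _) (is_deriveNid t 1)).
Qed.

Lemma derivable_LRcontinuous (F : R -> R) (a b : R) : a < b ->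
  (forall t, a <= t -> derivable F t (1:R)) -> derivable_oo_LRcontinuous F a b.
Proof.
move=> ab dF.
have cF t : a <= t -> {for t, continuous F}.
  by move=> /dF h; apply/differentiable_continuous/derivable1_diffP.
split.
- by move=> t; rewrite in_itv/= => /andP[/ltW at_ _]; exact: dF.
- exact/cvg_at_right_filter/cF.
- by apply/cvg_at_left_filter/cF; exact: ltW.
Qed.

Lemma integrable_gamma_density (x a b : R) : 0 < a ->
  mu.-integrable `[a, b] (EFin \o gamma_density x).
Proof.
move=> a0; apply: continuous_compact_integrable; first exact: segment_compact.
apply: derivable_within_continuous => t; rewrite in_itv/= => /andP[at_ _].
apply: derivableM; first by apply: derivable_powR; rewrite in_itv/= andbT (lt_le_trans a0).
apply: ex_derive; exact: is_derive_expRN.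
Qed.

Lemma gamma_density_by_parts (x a b : R) : 0 < a -> a < b ->
  \int[mu]_(t in `[a, b]) gamma_density (x + 1) t =
  (a `^ x * expR (- a) - b `^ x * expR (- b)) +
  x * \int[mu]_(t in `[a, b]) gamma_density x t.
Proof.
move=> a0 ab.
have dpow (y t : R) : a <= t -> derivable (fun s : R => s `^ y) t 1.
  by move=> at_; apply: derivable_powR; rewrite in_itv/= andbT (lt_le_trans a0).
have dexp (t : R) : is_derive t (1:R) (fun s : R => - expR (- s)) (expR (- t)).
  by rewrite -[expR (- t)]opprK; apply: is_deriveN; exact: is_derive_expRN.
have cin (f : R -> R) : (forall t, a <= t -> derivable f t (1:R)) -> {within `[a, b], continuous f}.
  move=> df; apply: derivable_within_continuous => t.
  by rewrite in_itv/= => /andP[/df].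
rewrite /gamma_density addrK.
rewrite (@Rintegration_by_parts _ (fun t => t `^ x) (fun t => - expR (- t))
   (fun t => x * t `^ (x - 1)) (fun t => expR (- t))) => //.
- have -> : (fun t => x * t `^ (x - 1) * - expR (- t)) =
     (fun t => - x * gamma_density x t).
    by apply/funext => t; rewrite /gamma_density; ring.
  rewrite RintegralZl//; first by rewrite /gamma_density; ring.
  exact: integrable_gamma_density.
- by apply: cin => t at_; apply: derivableM; [exact: derivable_cst|exact: dpow].
- by apply: derivable_LRcontinuous => // t; exact: dpow.
- move=> t; rewrite in_itv/= => /andP[at_ _]; rewrite powR_derive1//.
  by rewrite in_itv/= andbT (lt_trans a0).
- by apply: cin => t _; apply: ex_derive; exact: is_derive_expRN.
- by apply: derivable_LRcontinuous => // t _; exact: ex_derive.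
- by move=> t _; rewrite derive1E; exact: derive_val.
Qed.

(** The bound starts at 2, which makes every interval nondegenerate, as needed
    for integrating by parts. *)
Definition exhaustion (k : nat) : set R := `[k.+2%:R^-1, k.+2%:R].

Lemma cvg_boundary_right (x : R) :
  k.+2%:R `^ x * expR (- k.+2%:R) @[k --> \oo] --> (0 : R).
Proof.
have [N xN] : exists N : nat, x <= N%:R.
  exists (Num.bound `|x|); apply: (le_trans (ler_norm x)); apply: ltW.
  exact: archi_boundP.
have H : N.+1`!%:R * harmonic k @[k --> \oo] --> N.+1`!%:R * (0 : R).
  by apply: cvgMl_tmp; exact: cvg_harmonic.
rewrite mulr0 in H.
apply: (squeeze_cvgr _ (cvg_cst 0) H); apply: nearW => k.
rewrite mulr_ge0 ?powR_ge0 ?expR_ge0//=.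
set b : R := k.+2%:R; have b0 : 0 < b by rewrite ltr0n.
have b1 : 1 <= b by rewrite ler1n.
apply: (@le_trans _ _ (b ^+ N * expR (- b))).
  rewrite ler_wpM2r ?expR_ge0// -powR_mulrn ?(ltW b0)//.
  exact: (ler_powR b1 xN).
have := expR_ge1Dxn N (ltW b0); set F : R := N.+1`!%:R => hexp.
have F0 : 0 < F by rewrite ltr0n fact_gt0.
have bk : b^-1 <= harmonic k by rewrite /harmonic /b lef_pV2 ?posrE ?ltr0n// ler_nat.
clearbody F b.
have hb : b ^+ N.+1 / F <= expR b by apply: le_trans hexp; rewrite lerDr.
apply: (@le_trans _ _ (F / b)).
  rewrite expRN ler_pdivrMr ?expR_gt0//.
  apply: (@le_trans _ _ (F / b * (b ^+ N.+1 / F))).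
    rewrite exprS le_eqVlt; apply/orP; left; apply/eqP; field.
    by rewrite !gt_eqF.
  by rewrite ler_wpM2l// divr_ge0// ltW.
by rewrite ler_pM2l.
Qed.

Lemma cvg_boundary_left (x : R) : 0 < x ->
  k.+2%:R^-1 `^ x * expR (- k.+2%:R^-1) @[k --> \oo] --> (0 : R).
Proof.
move=> x0.
have H : k.+2%:R^-1 `^ x @[k --> \oo] --> (0 : R).
  move/cvg_at_rightP : (powR_cvg0 x0) => /(_ (fun k => k.+2%:R^-1)); apply; split.
    by move=> k; rewrite invr_gt0.
  have := @cvg_harmonic R; rewrite -(cvg_shiftn 1); apply: cvg_trans.
  by apply: near_eq_cvg; apply: nearW => k /=; rewrite addn1.
apply: (squeeze_cvgr _ (cvg_cst 0) H); apply: nearW => k.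
rewrite mulr_ge0 ?powR_ge0 ?expR_ge0//=.
by rewrite ler_piMr ?powR_ge0// expR_le1 oppr_le0 invr_ge0.
Qed.

Lemma cvg_egamma (x : R) :
  (\int[mu]_(t in exhaustion k) (gamma_density x t)%:E)%E @[k --> \oo] --> egamma x.
Proof.
have -> : egamma x = (\int[mu]_(t in \bigcup_k exhaustion k) (gamma_density x t)%:E)%E.
  congr (integral _ _ _); apply/seteqP; split=> t /=.
    rewrite in_itv/= andbT => t0.
    have tb := archi_boundP (ltW t0).
    have tib : t^-1 < (Num.bound t^-1)%:R by apply: archi_boundP; rewrite invr_ge0 ltW.
    exists (maxn (Num.bound t) (Num.bound t^-1)) => //.
    rewrite /exhaustion /= in_itv/=; set m := maxn _ _.
    have h1 : t <= m.+2%:R.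
      by rewrite (le_trans (ltW tb))// ler_nat ltnW// ltnW// !ltnS leq_maxl.
    have h2 : t^-1 <= m.+2%:R.
      by rewrite (le_trans (ltW tib))// ler_nat ltnW// ltnW// !ltnS leq_maxr.
    by rewrite h1 andbT -[leRHS]invrK lef_pV2 ?posrE ?invr_gt0// ltr0n.
  move=> [k _]; rewrite /exhaustion /= !in_itv/= andbT => /andP[+ _].
  by apply: lt_le_trans; rewrite invr_gt0.
apply: ge0_nondecreasing_set_cvg_integral.
- apply/nondecreasing_seqP => k; apply/subsetPset => t.
  rewrite /exhaustion /= !in_itv/= => /andP[h1 h2]; apply/andP; split.
    by apply: le_trans h1; rewrite lef_pV2 ?posrE ?ltr0n// ler_nat.
  by apply: (le_trans h2); rewrite ler_nat.
- by move=> k; exact: measurable_itv.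
- by move=> k; apply/measurable_EFinP; exact: measurable_gamma_density.
- by move=> k t _; rewrite lee_fin gamma_density_ge0.
Qed.

(** Limit of [gamma_density_by_parts] along [exhaustion]: the boundary terms
    vanish and the integrals converge monotonically in [0, +oo]. *)
Lemma egammaS (x : R) : 0 < x -> egamma (x + 1) = (x%:E * egamma x)%E.
Proof.
move=> x0.
pose I (y : R) k := \int[mu]_(t in exhaustion k) gamma_density y t.
have fin (y : R) k : (\int[mu]_(t in exhaustion k) (gamma_density y t)%:E)%E = (I y k)%:E.
  rewrite /I /Rintegral fineK//; apply: integrable_fin_num; first exact: measurable_itv.
  by apply: (@integrable_gamma_density y k.+2%:R^-1 k.+2%:R); rewrite invr_gt0.
pose B k : R := k.+2%:R^-1 `^ x * expR (- k.+2%:R^-1) - k.+2%:R `^ x * expR (- k.+2%:R).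
have step k : I (x + 1) k = B k + x * I x k.
  apply: gamma_density_by_parts; first by rewrite invr_gt0.
  by rewrite (@lt_le_trans _ _ 1)// ?ler1n// invf_lt1// ltr1n.
have cB : B k @[k --> \oo] --> (0 : R).
  rewrite -[X in _ --> X](subrr 0); apply: cvgB; [exact: cvg_boundary_left|exact: cvg_boundary_right].
have cI (y : R) : (I y k)%:E @[k --> \oo] --> egamma y.
  by have := @cvg_egamma y; rewrite (funext (fin y)).
clearbody I B.
have c2 : ((B k)%:E + x%:E * (I x k)%:E)%E @[k --> \oo] --> (0%:E + x%:E * egamma x)%E.
  apply: cvgeD; first by rewrite fin_num_adde_defr.
  - by apply: cvg_EFin; [exact: nearW|exact: cB].
  - by apply: cvgeZl => //; exact: cI.
rewrite add0e in c2; apply: (cvg_unique _ (cI (x + 1))) => //.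
rewrite (_ : (fun k => (I (x + 1) k)%:E) = (fun k => ((B k)%:E + x%:E * (I x k)%:E)%E)) //.
by apply/funext => k; rewrite step EFinD EFinM.
Qed.

Lemma integral_expRN (a : R) :
  (\int[mu]_(t in `[a, +oo[) (expR (- t))%:E)%E = (expR (- a))%:E.
Proof.
have dF (t : R) : is_derive t (1:R) (fun s : R => - expR (- s)) (expR (- t)).
  by rewrite -[expR (- t)]opprK; apply: is_deriveN; exact: is_derive_expRN.
have cE : continuous (fun s : R => expR (- s)).
  move=> t; apply/differentiable_continuous/derivable1_diffP.
  by apply: ex_derive; exact: is_derive_expRN.
rewrite (@ge0_continuous_FTC2y _ _ (fun s : R => - expR (- s)) a 0).
- by rewrite sub0e EFinN oppeK.
- by move=> t _; exact: expR_ge0.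
- exact: continuous_subspaceT.
- by rewrite -oppr0; apply: cvgN; exact: cvgr_expR.
- by move=> t _; apply: ex_derive.
- by apply/cvg_at_right_filter; apply: cvgN; exact: cE.
- by move=> t _; rewrite derive1E; exact: derive_val.
Qed.

Lemma gamma_density1 : gamma_density 1 = (fun t : R => expR (- t)).
Proof. by apply/funext => t; rewrite /gamma_density subrr powRr0 mul1r. Qed.

Lemma measurable_EFin_gamma_density (x : R) (D : set R) :
  measurable_fun D (fun t => (gamma_density x t)%:E).
Proof. by apply/measurable_EFinP; exact: measurable_gamma_density. Qed.

Lemma egamma1 : egamma 1 = 1%E.
Proof.
rewrite /egamma integral_itv_obnd_cbnd; last exact: measurable_EFin_gamma_density.
by rewrite gamma_density1 integral_expRN oppr0 expR0.
Qed.

Lemma egamma_ge0 (x : R) : (0 <= egamma x)%E.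
Proof. by apply: integral_ge0 => t _; rewrite lee_fin gamma_density_ge0. Qed.

Lemma egamma_nat (n : nat) : egamma n.+1%:R \is a fin_num.
Proof.
elim: n => [|n IH]; first by rewrite egamma1.
by rewrite -natr1 egammaS ?ltr0n// fin_numM.
Qed.

(** For 1 <= x the density is at most the sum of those of 1 and of a larger
    integer; for x < 1 the functional equation brings back to x + 1. *)
Lemma egamma_fin_num (x : R) : 0 < x -> egamma x \is a fin_num.
Proof.
have ge1 (y : R) : 1 <= y -> egamma y \is a fin_num.
  move=> y1; have y0 : 0 <= y by rewrite (le_trans _ y1).
  set N := Num.bound y; have yN : y <= N%:R by rewrite ltW// archi_boundP.
  rewrite ge0_fin_numE ?egamma_ge0//.
  apply: (@le_lt_trans _ _ (egamma 1 + egamma N.+1%:R)%E); last first.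
    by rewrite egamma1 ltey_eq fin_numD egamma_nat.
  have g0 (z t : R) : (0 <= (gamma_density z t)%:E)%E by rewrite lee_fin gamma_density_ge0.
  rewrite /egamma -ge0_integralD//; try exact: measurable_EFin_gamma_density.
  apply: ge0_le_integral => //; first exact: measurable_EFin_gamma_density.
    by apply: emeasurable_funD; exact: measurable_EFin_gamma_density.
  move=> t; rewrite /= in_itv/= andbT => t0; rewrite -EFinD lee_fin /gamma_density -mulrDl.
  rewrite ler_wpM2r ?expR_ge0// subrr powRr0 -natr1 addrK.
  have [t1|t1] := leP 1 t.
    apply: (@le_trans _ _ (t `^ N%:R)); last by rewrite lerDr.
    by apply: ler_powR => //; rewrite lerBlDr (le_trans yN)// lerDl.
  apply: (@le_trans _ _ 1); last by rewrite lerDl powR_ge0.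
  rewrite -[leRHS](powRr0 t); apply: ger_powR; last by rewrite subr_ge0.
  by rewrite t0 ltW.
move=> x0; have [x1|x1] := leP 1 x; first exact: ge1.
have := ge1 (x + 1); rewrite egammaS// lerDr ltW// => /(_ isT).
by have := egamma_ge0 x; case: (egamma x) => //= _; rewrite gt0_muley.
Qed.

Lemma GammaE (x : R) : Gamma x = fine (egamma x).
Proof. by []. Qed.

Lemma GammaS (x : R) : 0 < x -> Gamma (x + 1) = x * Gamma x.
Proof. by move=> x0; rewrite (GammaE (x + 1)) (GammaE x) egammaS// fineM// egamma_fin_num. Qed.

(** For 1 <= x the density dominates exp (- t) on [1, +oo[; the functional
    equation gives the remaining x. *)
Lemma Gamma_gt0 (x : R) : 0 < x -> 0 < Gamma x.
Proof.
have ge1 (y : R) : 1 <= y -> 0 < Gamma y.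
  move=> y1; have y0 : 0 < y by rewrite (lt_le_trans _ y1).
  rewrite GammaE -lte_fin fineK ?egamma_fin_num//.
  apply: (@lt_le_trans _ _ (expR (- 1))%:E); first by rewrite lte_fin expR_gt0.
  rewrite -integral_expRN.
  apply: (@le_trans _ _ (\int[mu]_(t in `[1%R, +oo[) (gamma_density y t)%:E)%E).
    apply: ge0_le_integral => //.
    - by have := @measurable_EFin_gamma_density 1 `[1, +oo[; rewrite gamma_density1.
    - exact: measurable_EFin_gamma_density.
    - move=> t; rewrite /= in_itv/= andbT => t1; rewrite lee_fin /gamma_density.
      rewrite ler_peMl ?expR_ge0// -[leLHS](powRr0 t).
      by apply: ler_powR => //; rewrite subr_ge0.
  apply: ge0_subset_integral => //; first exact: measurable_EFin_gamma_density.
    by move=> t _; rewrite lee_fin gamma_density_ge0.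
  by move=> t; rewrite /= !in_itv/= !andbT; apply: lt_le_trans.
move=> x0; have := ge1 (x + 1); rewrite lerDr ltW// GammaS// => /(_ isT).
by rewrite pmulr_rgt0.
Qed.

End GammaFunction.

(** * The Schoenberg kernel in dimensions n and n+1 *)

Section Omega.
Context {R : realType}.

Lemma GammaD_poch (a : R) j : 0 < a -> Gamma (j%:R + a) = poch a j * Gamma a.
Proof.
move=> a0; elim: j => [|j IH]; first by rewrite add0r /poch big_ord0 mul1r.
by rewrite -natr1 addrAC GammaS ?ltr_wpDl// IH pochS; ring.
Qed.

Lemma Omega_psum n (s : R) : (0 < n)%N -> Omega n s = psum (omega (n%:R / 2)) (s ^+ 2).
Proof.
move=> n0; rewrite /Omega /psum /bessel_order; set a : R := n%:R / 2.
have a0 : 0 < a by rewrite divr_gt0// ltr0n.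
congr (lim (_ @ \oo)); apply/funext => m; rewrite /pseries /series /=.
apply: eq_bigr => j _; rewrite subrK -addrA subrK GammaD_poch//.
have := Gamma_gt0 a0; move: (Gamma a) => G G0.
rewrite /omega [(- (s ^+ 2 / 4)) ^+ j]exprNn expr_div_n; field.
by rewrite natr_fact_neq0 poch_neq0// (gt_eqF G0) ?expf_neq0.
Qed.

Lemma continuous_Omega n : (0 < n)%N -> continuous (@Omega R n).
Proof.
move=> n0; have -> : @Omega R n = psum (omega (n%:R / 2)) \o (fun s => s ^+ 2).
  by apply/funext => s; rewrite Omega_psum.
move=> s; apply: continuous_comp; first exact: exprn_continuous.
apply/differentiable_continuous/derivable1_diffP; apply: ex_derive.
by apply: is_derive_psum; exact: exp_type_omega.
Qed.

Lemma complex_sum (I : Type) (r : seq I) (f g : I -> R) :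
  (\sum_(i <- r) (f i +i* g i) = (\sum_(i <- r) f i) +i* (\sum_(i <- r) g i))%C.
Proof.
elim: r => [|i r IH]; first by rewrite !big_nil.
by rewrite !big_cons IH.
Qed.

(** For a symmetric real kernel, the form at the complex weights u + i v is the
    sum of the real forms at u and at v: the imaginary part cancels by
    antisymmetry. *)
Lemma radial_psd_Phi n (f phi : R -> R) :
  {within `[(0:R), +oo[, continuous f} -> (forall t, f t = phi (t ^+ 2)) ->
  radial_psd n phi -> Phi n f.
Proof.
move=> cf fphi pphi; split=> // N x xi _.
pose u k := complex.Re (xi k); pose v k := complex.Im (xi k).
pose K k j : R := phi (sqnorm (x k - x j)).
have Ksym k j : K k j = K j k.
  rewrite /K; congr phi; rewrite /sqnorm; apply: eq_bigr => i _.
  by rewrite !mxE -sqrrN opprB.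
have nonneg (w : 'I_N -> R) : 0 <= \sum_k \sum_j K k j * (w k * w j).
  have := pphi [seq (x k, w k) | k <- index_enum 'I_N].
  by rewrite /quad big_map; under eq_bigr do rewrite big_map.
have -> : \sum_(k < N) \sum_(j < N)
    ((f (enorm (x k - x j)))%:C * xi j * (xi k)^*)%C =
  ((\sum_k \sum_j K k j * (u k * u j + v k * v j)) +i*
   (\sum_k \sum_j K k j * (u k * v j - v k * u j)))%C.
  rewrite -complex_sum; apply: eq_bigr => k _; rewrite -complex_sum.
  apply: eq_bigr => j _; rewrite fphi /enorm sqr_sqrtr; last first.
    by apply: sumr_ge0 => i _; exact: sqr_ge0.
  rewrite -/(sqnorm _) -/(K k j) /u /v; case: (xi j) (xi k) => [a b] [c d].
  apply/eqP; rewrite eq_complex /=; apply/andP; split; apply/eqP; ring.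
have -> : \sum_k \sum_j K k j * (u k * v j - v k * u j) = 0.
  have E : \sum_k \sum_j K k j * (v k * u j) = \sum_k \sum_j K k j * (u k * v j).
    rewrite exchange_big; apply: eq_bigr => k _; apply: eq_bigr => j _.
    by rewrite Ksym [v j * _]mulrC.
  under eq_bigr do under eq_bigr do rewrite mulrBr.
  under eq_bigr do rewrite sumrB.
  by rewrite sumrB E subrr.
rewrite lecE /= eqxx /=.
under eq_bigr do under eq_bigr do rewrite mulrDr.
under eq_bigr do rewrite big_split.
by rewrite big_split addr_ge0.
Qed.

Lemma Omega_Phi n : (0 < n)%N -> Phi n (@Omega R n).
Proof.
move=> n0; apply: (radial_psd_Phi (phi := psum (omega (n%:R / 2)))).
- exact/continuous_subspaceT/continuous_Omega.
- by move=> t; exact: Omega_psum.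
- exact: radial_psd_omega.
Qed.

Lemma Omega_notin_PhiS n : (0 < n)%N -> ~ Phi n.+1 (@Omega R n).
Proof.
move=> n0 pO; set a : R := n%:R / 2.
have a0 : 0 < a by rewrite divr_gt0// ltr0n.
pose c j : R := (4 ^+ j * j`!%:R * poch a j)^-1.
have [|C [d [C0 d0 taylor]]] := @taylor4_of_series _ (@Omega R n) c 1 ltr01.
  move=> z _; rewrite Omega_psum//.
  have : pseries (omega a) (z ^+ 2) @ \oo --> psum (omega a) (z ^+ 2).
    exact: exp_type_cvg (exp_type_omega n0).
  rewrite (_ : pseries _ _ = series (fun j => (-1) ^+ j * c j * z ^+ (2 * j))); first exact.
  by apply/funext => m; apply: eq_bigr => j _; rewrite /= exprM /omega.
have c0 : c 0%N = 1 by rewrite /c /poch big_ord0 expr0 fact0 !mul1r invr1.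
have c1 : c 1%N = (2 * n%:R)^-1.
  by rewrite /c pochS /poch big_ord0 mulr0n (_ : 1`! = 1%N)// /a; congr (_^-1); field.
have c2 : c 2%N = (8 * n%:R * (n%:R + 2))^-1.
  by rewrite /c !pochS /poch big_ord0 mulr0n (_ : 2`! = 2%N)// /a; congr (_^-1); field.
rewrite c0 in taylor.
have := fourth_order_necessary (ltn0Sn n) d0 C0 taylor pO; rewrite c1 c2 -natr1.
have N0 : (0:R) < n%:R by rewrite ltr0n.
move: (n%:R : R) N0 => N N0.
have -> : (N + 1) * (2 * N)^-1 ^+ 2 = (N + 1) * (N + 2) / (4 * N ^+ 2 * (N + 2)).
  by field; rewrite !gt_eqF// addr_gt0.
have -> : (2 * (N + 1) + 4) * (8 * N * (N + 2))^-1 = N * (N + 3) / (4 * N ^+ 2 * (N + 2)).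
  by field; rewrite !gt_eqF// addr_gt0.
rewrite ler_pM2r ?invr_gt0 ?mulr_gt0 ?exprn_gt0 ?addr_gt0//.
lra.
Qed.

End Omega.

Unset Implicit Arguments.

Theorem proposition2p2 (R : realType) :
  (forall (m : nat) (f : R -> R) (a : nat -> R),
      (0 < m)%N ->
      {within `[0, +oo[, continuous f} ->
      (forall t : R, 0 <= t -> f t <= 1) ->
      (exists2 delta : R, 0 < delta &
         forall z : R, 0 <= z < delta ->
           series (fun j : nat => (-1) ^+ j * a j * z ^+ (2 * j)) @ \oo --> f z) ->
      a 0%N = 1 ->
      (forall j : nat, (0 < j)%N -> 0 < a j) ->
      (2 * m%:R + 6) / (m%:R + 1) * a 2%N < a 1%N ^+ 2 ->
      ~ Phi m.+1 f) /\
  (forall n : nat, (0 < n)%N -> (@Phi R n `\` @Phi R n.+1) (@Omega R n)).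
Proof.
split; last by move=> n n0; split; [exact: Omega_Phi|exact: Omega_notin_PhiS].
move=> m f a _ _ _ [delta d0 cv] a0 _ lt_a pf.
have [C [d [C0 d'0 taylor]]] := taylor4_of_series d0 cv.
rewrite a0 in taylor.
have := fourth_order_necessary (ltn0Sn m) d'0 C0 taylor pf.
apply/negP; rewrite -ltNge -natr1.
have M0 : (0:R) < m%:R + 1 by rewrite ltr_wpDl.
move: lt_a; rewrite mulrAC ltr_pdivrMr// mulrC; congr (_ < _); ring.
Qed.
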